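(* Let $\mathcal{B}\subset\Omega^a$ be an invariant domain and let $\kappa\in\mathcal{T}_h$. Suppose that the numerical scheme satisfies the following three properties. (i) Cell-averaged update: $$\langle \mathbf{u}_h^{(n+1)}\rangle_\kappa=\langle \mathbf{u}_h^{(n)}\rangle_\kappa-\Delta t^{(n)}\sum_{k=1}^{N_f}s_k^\kappa\,\mathbf{h}\big(\mathbf{u}_h^-(\mathbf{x}_k^\kappa,t^{(n)}),\mathbf{u}_h^+(\mathbf{x}_k^\kappa,t^{(n)}),\mathbf{n}_k^\kappa\big).$$ (ii) Quadrature: $$\langle \mathbf{u}_h^{(n)}\rangle_\kappa=\sum_{i=1}^{N_v}\nu_i^\kappa\,\mathbf{u}_h(\mathbf{y}_i^\kappa,t^{(n)})+\sum_{i=1}^{N_f}\beta_i^\kappa\,\mathbf{u}_h^-(\mathbf{x}_i^\kappa,t^{(n)}),$$ with $\nu_i^\kappa\ge0$, $\beta_i^\kappa>0$ and $\sum_{i=1}^{N_v}\nu_i^\kappa+\sum_{i=1}^{N_f}\beta_i^\kappa=1$. (iii) Closed surface: $\sum_{k=1}^{N_f}s_k^\kappa\mathbf{n}_k^\kappa=0$. Suppose that the internal traces $\mathbf{u}_h^-(\mathbf{x}_k^\kappa,t^{(n)})$, $1\le k\le N_f$, are in $\mathcal{B}$. Then there exist $\mathbf{u}_\kappa^\star\in\mathcal{B}$ and a finite $\lambda_\kappa^\star>0$ such that $$\sum_{k=1}^{N_f}s_k^\kappa\,\mathbf{h}_{\lambda_\kappa^\star}\big(\mathbf{u}_\kappa^\star,\mathbf{u}_h^-(\mathbf{x}_k^\kappa,t^{(n)}),\mathbf{n}_k^\kappa\big)=0,$$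 where $\mathbf{h}_{\lambda}$ is the Rusanov flux, $$\lambda_\kappa^\star\ge\max_{1\le k\le N_f}|\lambda|\big(\mathbf{u}_\kappa^\star,\mathbf{u}_h^-(\mathbf{x}_k^\kappa,t^{(n)}),\mathbf{n}_k^\kappa\big),$$ and $$\mathbf{u}_\kappa^\star=\sum_{k=1}^{N_f}\tilde\gamma_k^\kappa\Big(\mathbf{u}_h^-(\mathbf{x}_k^\kappa,t^{(n)})-\frac{\mathbf{f}\big(\mathbf{u}_h^-(\mathbf{x}_k^\kappa,t^{(n)})\big)\cdot\mathbf{n}_k^\kappa}{\lambda_\kappa^\star}\Big),\qquad \tilde\gamma_k^\kappa:=\frac{s_k^\kappa}{\sum_{i=1}^{N_f}s_i^\kappa}.$$
   Context: Hyperbolic system: $\partial_t\mathbf{u}+\nabla\cdot\mathbf{f}(\mathbf{u})=0$ in $D\subset\mathbb{R}^d$, with $\mathbf{u}$ valued in a convex set of states $\Omega^a\subset\mathbb{R}^m$ and smooth flux $\mathbf{f}=(\mathbf{f}_1,\dots,\mathbf{f}_d):\Omega^a\to\mathbb{R}^{m\times d}$. Riemann problems: for a unit vector $\mathbf{n}\in\mathbb{R}^d$ and $\mathbf{u}_L,\mathbf{u}_R\in\Omega^a$, the Riemann problem $\partial_t\mathbf{u}+\partial_x\mathbf{f}(\mathbf{u})\cdot\mathbf{n}=0$, $\mathbf{u}(x,0)=\mathbf{u}_L$ for $x<0$ and $\mathbf{u}_R$ for $x>0$, is assumed to have a self-similar entropy weak solution $\mathcal{W}(x/t;\mathbf{u}_L,\mathbf{u}_R,\mathbf{n})$,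 and there are $\sigma_L,\sigma_R$ such that $\mathcal{W}(\xi;\mathbf{u}_L,\mathbf{u}_R,\mathbf{n})=\mathbf{u}_L$ for $\xi<\sigma_L$ and $\mathcal{W}(\xi;\mathbf{u}_L,\mathbf{u}_R,\mathbf{n})=\mathbf{u}_R$ for $\xi>\sigma_R$. The maximum wave speed is $|\lambda|(\mathbf{u}_L,\mathbf{u}_R,\mathbf{n})=\max(|\sigma_L|,|\sigma_R|)$. For $h,\Delta t>0$ with $\frac{\Delta t}{h}|\lambda|(\mathbf{u}_L,\mathbf{u}_R,\mathbf{n})\le\frac12$, the Riemann average is $$\bar{\mathbf{u}}=\frac1h\int_{-h/2}^{h/2}\mathcal{W}\Big(\frac{x}{\Delta t};\mathbf{u}_L,\mathbf{u}_R,\mathbf{n}\Big)dx=\frac{\mathbf{u}_L+\mathbf{u}_R}{2}-\frac{\Delta t}{h}\big(\mathbf{f}(\mathbf{u}_R)-\mathbf{f}(\mathbf{u}_L)\big)\cdot\mathbf{n}.$$ Invariant domain: a convex set $\mathcal{B}\subset\Omega^a$ such that for all $\mathbf{u}_L,\mathbf{u}_R\in\mathcal{B}$ (and all unit $\mathbf{n}$) $\bar{\mathbf{u}}\in\mathcal{B}$ whenever $\frac{\Delta t}{h}|\lambda|(\mathbf{u}_L,\mathbf{u}_R,\mathbf{n})\le\frac12$. Two-point flux $\mathbf{h}$: Lipschitz continuous, consistent ($\mathbf{h}(\mathbf{u},\mathbf{u},\mathbf{n})=\mathbf{f}(\mathbf{u})\cdot\mathbf{n}$), conservative ($\mathbf{h}(\mathbf{u}_L,\mathbf{u}_R,\mathbf{n})=-\mathbf{h}(\mathbf{u}_R,\mathbf{u}_L,-\mathbf{n})$),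 and invariant domain preserving for $\mathcal{B}$: $\mathbf{u}-\frac{\Delta t}{h}(\mathbf{h}(\mathbf{u},\mathbf{u}_R,\mathbf{n})-\mathbf{h}(\mathbf{u}_L,\mathbf{u},\mathbf{n}))\in\mathcal{B}$ for all $\mathbf{u}_L,\mathbf{u},\mathbf{u}_R\in\mathcal{B}$ whenever $\frac{\Delta t}{h}\max(|\lambda|(\mathbf{u}_L,\mathbf{u},\mathbf{n}),|\lambda|(\mathbf{u},\mathbf{u}_R,\mathbf{n}))\le\frac12$. Mesh and scheme: $\mathcal{T}_h$ is a partition of $D$ into cells $\kappa$; $\mathbf{u}_h(\cdot,t^{(n)})$ is the approximate solution, possibly discontinuous across faces; $\langle\cdot\rangle_\kappa$ is the (discrete) cell average; $\Delta t^{(n)}>0$ is the time step; $\mathbf{x}_k^\kappa$ ($1\le k\le N_f$) are points on $\partial\kappa$ with unit outward normals $\mathbf{n}_k^\kappa$ and coefficients $s_k^\kappa>0$; $\mathbf{y}_i^\kappa$ ($1\le i\le N_v$) are points in $\kappa$; $\mathbf{u}_h^\pm(\mathbf{x}_k^\kappa,t^{(n)})=\lim_{\epsilon\to0^+}\mathbf{u}_h(\mathbf{x}_k^\kappa\pm\epsilon\mathbf{n}_k^\kappa,t^{(n)})$ are the outer ($+$) and inner ($-$) traces. Rusanov flux: $\mathbf{h}_\lambda(\mathbf{u}_L,\mathbf{u}_R,\mathbf{n})=\frac{\mathbf{f}(\mathbf{u}_L)\cdot\mathbf{n}+\mathbf{f}(\mathbf{u}_R)\cdot\mathbf{n}}{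2}-\frac\lambda2(\mathbf{u}_R-\mathbf{u}_L)$.
   Formalization: It is additionally assumed that the maximum wave speed |λ|(u, u_R, n) is locally bounded in u on B for fixed u_R and n; without this, the choice of σ_L, σ_R can make the claim false. *)

(* Defs.v *)
From HB Require Import structures.
From mathcomp Require Import all_boot all_order all_algebra.
From mathcomp Require Import all_classical all_reals all_analysis.
Set Implicit Arguments.
Unset Strict Implicit.
Unset Printing Implicit Defensive.
Import Order.TTheory GRing.Theory Num.Theory.
Import numFieldNormedType.Exports.
Local Open Scope classical_set_scope.
Local Open Scope ring_scope.

(** States are columns ['cV[R]_m], points and directions of space are columns
    ['cV[R]_d], a flux is an [m x d] matrix and [f(u) . n] is [f u *m n].
    The norm of matrices in the library is the sup norm, so Euclidean lengths
    are written with [dotv]. *)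

Definition dotv (R : realType) (d : nat) (x y : 'cV[R]_d) : R :=
  \sum_(j < d) x j 0 * y j 0.

Definition unit_vector (R : realType) (d : nat) (n : 'cV[R]_d) : Prop :=
  dotv n n = 1.

(** [f] is of class [C^k] on [O], through iterated directional derivatives;
    meant for [O] open. *)
Fixpoint Ck_on (R : realType) (V W : normedModType R) (k : nat) (O : set V)
    (f : V -> W) : Prop :=
  (forall x, O x -> {for x, continuous f}) /\
  match k with
  | 0%N => True
  | k'.+1 => forall v : V,
      (forall x, O x -> derivable f x v) /\ Ck_on k' O (fun x => 'D_v f x)
  end.

(** Regularity on a set that need not be open is regularity on an open
    neighbourhood of it. *)
Definition Ck_near (R : realType) (V W : normedModType R) (k : nat) (A : set V)
    (f : V -> W) : Prop :=
  exists O : set V, [/\ open O, A `<=` O & Ck_on k O f].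

Definition smooth_near (R : realType) (V W : normedModType R) (A : set V)
    (f : V -> W) : Prop :=
  exists O : set V, [/\ open O, A `<=` O & forall k, Ck_on k O f].

Section HyperbolicSystem.
Context {R : realType} {m d : nat}.
Local Notation state := 'cV[R]_m.
Local Notation space := 'cV[R]_d.

Implicit Types (Omega B : set state) (f : state -> 'M[R]_(m, d)).

Definition flux_jacobian f (n : space) (u : state) : 'M[R]_m :=
  \matrix_(i, j) ('D_(delta_mx j 0) (fun v => f v *m n) u) i 0.

Definition hyperbolic Omega f : Prop :=
  forall u n, Omega u -> unit_vector n -> diagonalizable (flux_jacobian f n u).

(** Convex entropy pairs: [q'(u) . n = eta'(u) (f'(u) . n)]. *)
Definition entropy_pair Omega f (e : (state -> R) * (state -> 'rV[R]_d)) : Prop :=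
  [/\ Ck_near 1 Omega (e.1 : state -> R^o), Ck_near 1 Omega e.2,
      convex_function (Omega : set (convex_lmodType state)) e.1
    & forall u v n, Omega u ->
        'D_v (fun w => (e.2 w *m n) 0 0 : R^o) u =
        'D_('D_v (fun w => f w *m n) u) (e.1 : state -> R^o) u].

(** [C^1] functions of [(x, t)] with compact support in the plane; only their
    restriction to [t >= 0] matters below. *)
Definition test_function (phi : R^o * R^o -> R^o) : Prop :=
  Ck_on 1 setT phi /\ compact (closure [set z | phi z != 0]).

(** With [a] and [b] functions of [x / t], and [a] starting from [aL] for
    [x < 0] and [aR] for [x > 0], this is [- <d_t a + d_x b, phi>] in the sense of
    distributions, initial value included: it is zero for all [phi] when
    [d_t a + d_x b = 0], and nonnegative for all [phi >= 0] when
    [d_t a + d_x b <= 0]. *)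
Definition weak_form (a b : R -> R) (aL aR : R) (phi : R^o * R^o -> R^o) : R :=
  \int[lebesgue_measure]_(t in `]0, +oo[)
    (\int[lebesgue_measure]_(x in [set: R])
      (a (x / t) * 'D_(0, 1) phi (x, t) + b (x / t) * 'D_(1, 0) phi (x, t)))
  + \int[lebesgue_measure]_(x in [set: R])
      ((if x < 0 then aL else aR) * phi (x, 0)).

(** The self-similar function [(x, t) |-> w (x / t)] is a weak solution of the
    Riemann problem that satisfies the entropy inequality of each pair in [E]. *)
Definition entropy_weak_solution f (E : set ((state -> R) * (state -> 'rV[R]_d)))
    (uL uR : state) (n : space) (w : R -> state) : Prop :=
  (forall i : 'I_m,
    [/\ locally_integrable setT (fun xi => w xi i 0),
        locally_integrable setT (fun xi => (f (w xi) *m n) i 0)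
      & forall phi, test_function phi ->
          weak_form (fun xi => w xi i 0) (fun xi => (f (w xi) *m n) i 0)
                    (uL i 0) (uR i 0) phi = 0]) /\
  (forall e, E e ->
    [/\ locally_integrable setT (fun xi => e.1 (w xi)),
        locally_integrable setT (fun xi => (e.2 (w xi) *m n) 0 0)
      & forall phi, test_function phi -> (forall z, 0 <= phi z) ->
          0 <= weak_form (fun xi => e.1 (w xi)) (fun xi => (e.2 (w xi) *m n) 0 0)
                         (e.1 uL) (e.1 uR) phi]).

Record riemann_data := RiemannData {
  fan : R -> state -> state -> space -> state;
  sigmaL : state -> state -> space -> R;
  sigmaR : state -> state -> space -> R }.

Definition riemann_solver Omega f E (W : riemann_data) : Prop :=
  forall uL uR n, Omega uL -> Omega uR -> unit_vector n ->
  [/\ forall xi, Omega (fan W xi uL uR n),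
      entropy_weak_solution f E uL uR n (fun xi => fan W xi uL uR n),
      forall xi, xi < sigmaL W uL uR n -> fan W xi uL uR n = uL
    & forall xi, sigmaR W uL uR n < xi -> fan W xi uL uR n = uR].

Definition max_wave_speed (W : riemann_data) (uL uR : state) (n : space) : R :=
  Num.max `|sigmaL W uL uR n| `|sigmaR W uL uR n|.

Definition riemann_average (W : riemann_data) (h dt : R) (uL uR : state)
    (n : space) : state :=
  \col_i (h^-1 * \int[lebesgue_measure]_(x in `[- (h / 2), h / 2])
                   (fan W (x / dt) uL uR n i 0)).

Definition invariant_domain Omega (W : riemann_data) B : Prop :=
  [/\ convex_set (B : set (convex_lmodType state)), B `<=` Omega
    & forall uL uR n h dt, B uL -> B uR -> unit_vector n -> 0 < h -> 0 < dt ->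
        dt / h * max_wave_speed W uL uR n <= 1 / 2 ->
        B (riemann_average W h dt uL uR n)].

(** [sigmaL] and [sigmaR] only have to enclose the waves, so nothing else
    relates their values at neighbouring states: for [f(u) = u] with [m = d = 1],
    [sigmaR uL uR n] may blow up as [uL] tends to a given state. *)
Definition locally_bounded_wave_speed (W : riemann_data) B : Prop :=
  forall uL uR n, B uL -> B uR -> unit_vector n ->
  exists M : R,
    \forall v \near within B (nbhs uL), max_wave_speed W v uR n <= M.

Definition idp_flux (W : riemann_data) B
    (h : state -> state -> space -> state) : Prop :=
  forall uL u uR n hx dt, B uL -> B u -> B uR -> unit_vector n ->
    0 < hx -> 0 < dt ->
    dt / hx * Num.max (max_wave_speed W uL u n) (max_wave_speed W u uR n)
      <= 1 / 2 ->
    B (u - (dt / hx) *: (h u uR n - h uL u n)).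

Definition two_point_flux Omega f (W : riemann_data) B
    (h : state -> state -> space -> state) : Prop :=
  [/\ [lipschitz h z.1.1 z.1.2 z.2 |
        z in [set z : state * state * space |
               [/\ Omega z.1.1, Omega z.1.2 & unit_vector z.2]]],
      forall u n, Omega u -> unit_vector n -> h u u n = f u *m n,
      forall uL uR n, Omega uL -> Omega uR -> unit_vector n ->
        h uL uR n = - h uR uL (- n)
    & idp_flux W B h].

Definition rusanov_flux f (lambda : R) (uL uR : state) (n : space) : state :=
  2^-1 *: (f uL *m n + f uR *m n) - (lambda / 2) *: (uR - uL).

(** Cells may be open, closed or neither: they may only share boundary points
    and they cover [D] up to their boundaries. *)
Definition mesh (D : set space) (Th : set (set space)) : Prop :=
  [/\ forall K, Th K -> K° !=set0,
      forall K K', Th K -> Th K' -> K <> K' -> K° `&` K'° = set0,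
      forall K, Th K -> K `<=` closure D
    & D `<=` \bigcup_(K in Th) closure K].

(** [n] is the unit outward normal at the boundary point [x] of [K]: to first
    order at [x], [K] is the half-space [(y - x) . n <= 0]. *)
Definition outward_normal (K : set space) (x n : space) : Prop :=
  [/\ (closure K `\` K°) x, unit_vector n
    & forall e : R, 0 < e -> \forall y \near nbhs x,
        (K y -> dotv (y - x) n <= e * `|y - x|) /\
        (~ K y -> - (e * `|y - x|) <= dotv (y - x) n)].

Definition inner_trace (v : space -> state) (x n : space) : state :=
  lim (v (x - e *: n) @[e --> (0 : R)^'+]).

Definition outer_trace (v : space -> state) (x n : space) : state :=
  lim (v (x + e *: n) @[e --> (0 : R)^'+]).

Definition has_traces (v : space -> state) (x n : space) : Prop :=
  cvg (v (x - e *: n) @[e --> (0 : R)^'+]) /\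
  cvg (v (x + e *: n) @[e --> (0 : R)^'+]).

End HyperbolicSystem.
Arguments riemann_data : clear implicits.

(* Main.v *)
Require Import Defs.
From HB Require Import structures.
From mathcomp Require Import all_boot all_order all_algebra.
From mathcomp Require Import all_classical all_reals all_analysis.
From mathcomp Require Import measurable_realfun ring lra.
Set Implicit Arguments.
Unset Strict Implicit.
Unset Printing Implicit Defensive.
Import Order.TTheory GRing.Theory Num.Theory.
Import numFieldNormedType.Exports.
Local Open Scope classical_set_scope.
Local Open Scope ring_scope.

(** Testing the weak formulation of the Riemann problem against
    [plateau K x * plateau 1 t], with [K] so large that the fan stays inside the
    flat part, turns the conservation law into an identity for the integral of
    the fan over [-L, L], hence the usual formula for the Riemann average.
    Let [w] be the [gamma]-mean of the traces [v k], and [c] the [gamma]-mean of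
    [f (v k) . n_k]. Averaging over [k] the Riemann averages of [w] and [v k]
    gives [w - c / (2 lambda)], since the terms in [f w] cancel by the closed
    surface property; so this state is in [B] as soon as [lambda] bounds the wave
    speeds at [w], that is, [w - c / lambda] is in [B] for [lambda] at least twice
    this bound. As [lambda] tends to infinity that state tends to [w], where the
    wave speeds are locally bounded, so [lambda] also exceeds the wave speeds at
    that state. *)

(** * A [C^1] cut-off function on the line *)

Section Plateau.
Context {R : realType}.
Implicit Types x y K : R.

(** Squaring the positive part removes its corner: the derivative [2 * Num.max 0 y] is continuous,
    which is all that a [C^1] test function requires. *)
Definition possq y : R := Num.max 0 y ^+ 2.

Lemma possq_le0 y : y <= 0 -> possq y = 0.
Proof. by move=> y0; rewrite /possq max_l// expr0n. Qed.

Lemma possq_ge0 y : 0 <= y -> possq y = y ^+ 2.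
Proof. by move=> y0; rewrite /possq max_r. Qed.

Lemma continuous_pospart : continuous (fun y : R => Num.max 0 y).
Proof. by move=> y; apply: continuous_max; [exact: cvg_cst|exact: cvg_id]. Qed.

(** A quadratic remainder valid for every sign of [x] and [y]; it gives the derivative at the gluing
    point [0] with no separate argument. *)
Lemma possq_taylor x y :
  `|possq y - possq x - 2 * Num.max 0 x * (y - x)| <= (y - x) ^+ 2.
Proof.
rewrite /possq ler_norml.
have := sqr_ge0 (y - x).
case: (lerP 0 x) => x0; case: (lerP 0 y) => y0 yx2; apply/andP; split; nra.
Qed.

Lemma is_derive_possq x : is_derive x 1 possq (2 * Num.max 0 x).
Proof.
apply/is_derive1_caratheodory.
(* Carathéodory's slope function: the difference quotient, filled in at [x] by the expected
   derivative. By [possq_taylor] it differs from that value by at most [|y - x|]. *)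
exists (fun y => if y == x then 2 * Num.max 0 x
                 else (possq y - possq x) / (y - x)); split.
- move=> y; case: eqVneq => [->|yx]; first by rewrite !subrr mulr0.
  by rewrite divfK// subr_eq0.
- apply/cvgrPdist_le => /= e e0.
  near=> y; have xye : `|x - y| <= e.
    near: y; exact: (@cvgr_dist_le _ _ _ _ (nbhs_filter x) id x cvg_id _ e0).
  rewrite eqxx; case: eqVneq => [_|yx]; first by rewrite subrr normr0 ltW.
  have yx0 : y - x != 0 by rewrite subr_eq0.
  rewrite distrC.
  have -> : (possq y - possq x) / (y - x) - 2 * Num.max 0 x =
    (possq y - possq x - 2 * Num.max 0 x * (y - x)) / (y - x) by field.
  rewrite normrM normfV ler_pdivrMr ?normr_gt0//.
  apply: (le_trans (possq_taylor x y)).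
  by rewrite -[leLHS]real_normK ?num_real// expr2 ler_pM2r ?normr_gt0// distrC.
- by rewrite eqxx.
Unshelve. all: by end_near. Qed.

(** The inner terms vanish for [|x| <= K], and one of them is at least [1] once [|x| >= K + 1]. The
    outer [possq] then truncates smoothly, so the function is [1] on [[-K, K]] and, for [K >= 0],
    [0] outside [[-K-1, K+1]]. *)
Definition plateau K x : R := possq (1 - possq (x - K) - possq (- x - K)).

Definition dplateau K x : R :=
  2 * Num.max 0 (1 - possq (x - K) - possq (- x - K)) *
  (2 * Num.max 0 (- x - K) - 2 * Num.max 0 (x - K)).

Lemma is_derive_plateau K x : is_derive x 1 (plateau K) (dplateau K x).
Proof.
have d1 : is_derive x 1 (fun y : R => possq (y - K)) (2 * Num.max 0 (x - K)).
  have h := is_derive_possq (x - K).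
  rewrite -[X in is_derive _ _ _ X]mulr1.
  apply: (@is_derive1_comp _ possq (fun y => y - K)).
  by apply: is_derive_eq; rewrite subr0.
have d2 : is_derive x 1 (fun y : R => possq (- y - K)) (- (2 * Num.max 0 (- x - K))).
  have h := is_derive_possq (- x - K).
  rewrite -[X in is_derive _ _ _ X]mulrN1.
  apply: (@is_derive1_comp _ possq (fun y => - y - K)).
  by apply: is_derive_eq; rewrite subr0.
rewrite /dplateau.
have h := is_derive_possq (1 - possq (x - K) - possq (- x - K)).
apply: (@is_derive1_comp _ possq (fun y => 1 - possq (y - K) - possq (- y - K))).
apply: is_derive_eq. ring.
Qed.

Lemma continuous_possq : continuous possq.
Proof.
move=> x; apply: differentiable_continuous; apply/derivable1_diffP.
by have [] := is_derive_possq x.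
Qed.

Lemma continuous_plateau K : continuous (plateau K).
Proof.
move=> x; apply: differentiable_continuous; apply/derivable1_diffP.
by have [] := is_derive_plateau K x.
Qed.

Lemma continuous_dplateau K : continuous (dplateau K).
Proof.
have c1 : continuous (fun x : R => x - K).
  by move=> x; apply: cvgB; [exact: cvg_id|exact: cvg_cst].
have c2 : continuous (fun x : R => - x - K).
  by move=> x; apply: cvgB; [apply: cvgN; exact: cvg_id|exact: cvg_cst].
have cc (f g : R -> R) : continuous f -> continuous g -> continuous (g \o f).
  by move=> cf cg x; apply: continuous_comp; [exact: cf|exact: cg].
have := cc _ _ c1 continuous_possq; have := cc _ _ c2 continuous_possq.
have := cc _ _ c1 continuous_pospart; have := cc _ _ c2 continuous_pospart.
move=> pc2 pc1 qc2 qc1.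
have ca : continuous (fun x : R => 1 - possq (x - K) - possq (- x - K)).
  by move=> x; apply: cvgB; [apply: cvgB; [exact: cvg_cst|exact: qc1]|exact: qc2].
have := cc _ _ ca continuous_pospart => pca x.
apply: cvgM; first by apply: cvgM; [exact: cvg_cst|exact: pca].
by apply: cvgB; (apply: cvgM; [exact: cvg_cst|]); [exact: pc2|exact: pc1].
Qed.

Lemma plateau1 K x : `|x| <= K -> plateau K x = 1.
Proof.
rewrite ler_norml => /andP[xK Kx]; rewrite /plateau.
rewrite (@possq_le0 (x - K)) ?(@possq_le0 (- x - K)); [|lra..].
by rewrite !subr0 possq_ge0// expr1n.
Qed.

Lemma plateau_arg_le0 K x : 0 <= K -> K + 1 <= `|x| ->
  1 - possq (x - K) - possq (- x - K) <= 0.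
Proof.
move=> K0; rewrite ler_normr => /orP[xK|xK].
  rewrite (@possq_ge0 (x - K)); last lra.
  by rewrite (@possq_le0 (- x - K)); [nra|lra].
rewrite (@possq_le0 (x - K)); last lra.
by rewrite (@possq_ge0 (- x - K)); [nra|lra].
Qed.

Lemma plateau0 K x : 0 <= K -> K + 1 <= `|x| -> plateau K x = 0.
Proof. by move=> K0 Kx; rewrite /plateau possq_le0// plateau_arg_le0. Qed.

Lemma plateau_ge0 K x : 0 <= plateau K x.
Proof. by rewrite /plateau /possq sqr_ge0. Qed.

Lemma dplateau0 K x : `|x| <= K -> dplateau K x = 0.
Proof.
rewrite ler_norml => /andP[xK Kx]; rewrite /dplateau.
by rewrite (@max_l _ _ 0 (- x - K)) ?(@max_l _ _ 0 (x - K)) ?subrr ?mulr0//; lra.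
Qed.

Lemma dplateau0_out K x : 0 <= K -> K + 1 <= `|x| -> dplateau K x = 0.
Proof.
by move=> K0 Kx; rewrite /dplateau max_l ?plateau_arg_le0// mulr0 mul0r.
Qed.

End Plateau.

(** * Products [p x * q t] as test functions on the plane *)

Section ProductTestFunction.
Context {R : realType}.
Variables (p q dp dq : R -> R) (N : R).
Hypothesis derp : forall x : R, is_derive x 1 p (dp x).
Hypothesis derq : forall x : R, is_derive x 1 q (dq x).
Hypothesis contdp : continuous dp.
Hypothesis contdq : continuous dq.

Let phi (z : R^o * R^o) : R^o := p z.1 * q z.2.

Let diff_of_derive (f df : R -> R) (x : R) : is_derive x 1 f (df x) ->
  is_diff x (f : R^o -> R^o) (fun h => h *: df x).
Proof.
move=> [fx <-]; apply: DiffDef; first exact/derivable1_diffP.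
by apply/funext => h; rewrite deriv1E// derive1E.
Qed.

Let cont_of_derive (f df : R -> R) : (forall x : R, is_derive x 1 f (df x)) ->
  continuous f.
Proof.
move=> h x; apply: differentiable_continuous; apply/derivable1_diffP.
by have [] := h x.
Qed.

(** Product rule applied to [p] and [q] composed with the two linear projections. Full
    differentiability gives both continuity and all directional derivatives. *)
Lemma is_diff_prod_fun z :
  is_diff z phi (fun v => p z.1 * (v.2 * dq z.2) + q z.2 * (v.1 * dp z.1)).
Proof.
have dfst : is_diff z (fst : R^o * R^o -> R^o) (fst : R^o * R^o -> R^o).
  apply: DiffDef; first by apply: linear_differentiable => ?; exact: cvg_fst.
  by apply: diff_lin => ?; exact: cvg_fst.
have dsnd : is_diff z (snd : R^o * R^o -> R^o) (snd : R^o * R^o -> R^o).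
  apply: DiffDef; first by apply: linear_differentiable => ?; exact: cvg_snd.
  by apply: diff_lin => ?; exact: cvg_snd.
have dp1 := is_diff_comp dfst (diff_of_derive (derp z.1)).
have dq2 := is_diff_comp dsnd (diff_of_derive (derq z.2)).
exact: is_diffM dp1 dq2.
Qed.

Lemma derive_prod_fun z v :
  'D_v phi z = p z.1 * (v.2 * dq z.2) + q z.2 * (v.1 * dp z.1).
Proof.
have [d e] := is_diff_prod_fun z.
by rewrite deriveE// e.
Qed.

Lemma test_function_prod :
  (forall x, N <= `|x| -> p x = 0) -> (forall x, N <= `|x| -> q x = 0) ->
  test_function phi.
Proof.
move=> p0 q0; split.
  split=> [z _|v].
    by apply: differentiable_continuous; have [] := is_diff_prod_fun z.
  split=> [z _|].
    by apply: diff_derivable; have [] := is_diff_prod_fun z.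
  split=> // z _.
  have -> : (fun x => 'D_v phi x) =
      (fun z => p z.1 * (v.2 * dq z.2) + q z.2 * (v.1 * dp z.1)).
    by apply/funext => w; exact: derive_prod_fun.
  have c1 (f : R -> R) :
      continuous f -> {for z, continuous (fun z : R^o * R^o => f z.1)}.
    by move=> cf; apply: (@continuous_comp _ _ _ fst f); [exact: cvg_fst|exact: cf].
  have c2 (f : R -> R) :
      continuous f -> {for z, continuous (fun z : R^o * R^o => f z.2)}.
    by move=> cf; apply: (@continuous_comp _ _ _ snd f); [exact: cvg_snd|exact: cf].
  apply: cvgD; apply: cvgM.
  - exact: c1 (cont_of_derive derp).
  - by apply: cvgM; [exact: cvg_cst|exact: c2].
  - exact: c2 (cont_of_derive derq).
  - by apply: cvgM; [exact: cvg_cst|exact: c1].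
(* Where the product is nonzero both factors are, so the support lies in this square, which is
   closed because it is compact in a Hausdorff space. *)
have cN : compact (`[- N, N]%classic `*` `[- N, N]%classic : set (R^o * R^o)).
  by apply: compact_setX; exact: segment_compact.
apply: (subclosed_compact _ cN); first exact: closed_closure.
have /closure_id -> : closed (`[- N, N]%classic `*` `[- N, N]%classic : set (R^o * R^o)).
  by apply: compact_closed cN; exact: norm_hausdorff.
apply: closure_subset => -[x t] /=; rewrite /phi mulf_eq0 negb_or => /andP[px qt].
split; rewrite /= in_itv/= -ler_norml leNgt; apply/negP => /ltW h.
- by rewrite p0 ?eqxx in px.
- by rewrite q0 ?eqxx in qt.
Qed.

End ProductTestFunction.

(** * The change of variable [x / c] in Lebesgue integrals *)

Section Dilation.
Context {R : realType}.
Notation mu := (@lebesgue_measure R).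

Lemma measurable_dilation (c : R) :
  measurable_fun [set: measurableTypeR R] (fun x => x / c : measurableTypeR R).
Proof. by apply: measurable_funM. Qed.

Lemma preimage_dilation_itv (c : R) (b1 b2 : bool) (l r : R) : 0 < c ->
  (fun x => x / c) @^-1` [set` Interval (BSide b1 l) (BSide b2 r)] =
  [set` Interval (BSide b1 (l * c)) (BSide b2 (r * c))].
Proof.
move=> c0; apply/seteqP; split => x /=; rewrite !itv_boundlr;
  by case: b1; case: b2; rewrite /Order.le/= ?ler_pdivlMr ?ltr_pdivlMr
    ?ler_pdivrMr ?ltr_pdivrMr.
Qed.

(** The pushforward of [mu] under [x / c], scaled by [c^-1], is a measure that gives bounded
    intervals their length; uniqueness of Lebesgue measure identifies it with [mu]. *)
Lemma lebesgue_measure_dilation (c : R) (A : set R) : 0 < c -> measurable A ->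
  mu A = ((c^-1)%:E * mu ((fun x => (x / c)%R) @^-1` A))%E.
Proof.
move=> c0 mA; have ci0 : 0 <= c^-1 by rewrite invr_ge0 ltW.
pose phi x : measurableTypeR R := x / c.
pose m : {measure set (measurableTypeR R) -> \bar R} :=
  mscale (NngNum ci0) (pushforward mu phi).
apply: (@lebesgue_measure_unique R (m (@measurable_dilation c))) => // _ [[a b]] _ <-.
rewrite /= /mscale /= /pushforward preimage_dilation_itv//.
rewrite !lebesgue_measure_itv/=.
rewrite !lte_fin ltr_pM2r//; case: ifPn => _; last by rewrite mule0.
by rewrite -!EFinB -EFinM -mulrBl mulrCA mulVf ?mulr1// gt_eqF.
Qed.

Lemma ge0_integral_dilation (c : R) (D : set R) (f : R -> \bar R) : 0 < c ->
  measurable D -> measurable_fun D f -> (forall x, 0 <= f x)%E ->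
  (\int[mu]_(x in (fun x => (x / c)%R) @^-1` D) f (x / c)%R =
   c%:E * \int[mu]_(x in D) f x)%E.
Proof.
move=> c0 mD mf f0; have ci0 : 0 <= c^-1 by rewrite invr_ge0 ltW.
pose phi x : measurableTypeR R := x / c.
have mphi : measurable_fun [set: measurableTypeR R] phi by exact: measurable_dilation.
have /(_ (fun x _ => f0 x)) /= <- :=
  @ge0_integral_pushforward _ _ (measurableTypeR R) (measurableTypeR R) R phi mphi mu D f mD mf.
pose m : {measure set (measurableTypeR R) -> \bar R} :=
  mscale (NngNum ci0) (pushforward mu phi).
rewrite (@eq_measure_integral _ (measurableTypeR R) _ D (m mphi) mu); last first.
  by move=> A mA _; exact: (@lebesgue_measure_dilation c A).
rewrite ge0_integral_mscale//= muleA -EFinM divff ?gt_eqF// mul1e.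
by [].
Qed.

Lemma integrable_dilation (c : R) (D : set R) (f : R -> R) : 0 < c ->
  measurable D -> mu.-integrable D (EFin \o f) ->
  mu.-integrable ((fun x => x / c) @^-1` D) (fun x => (f (x / c))%:E).
Proof.
move=> c0 mD /integrableP[mf fi]; apply/integrableP; split.
  apply: (@measurable_comp _ _ _ (measurableTypeR R) (measurableTypeR R) _ D
    (EFin \o f) _ (fun x => x / c)) => //.
  - by move=> _ [x Dx <-].
  - by apply: measurable_funTS; exact: measurable_dilation.
rewrite (@ge0_integral_dilation c D (fun x => `|(f x)%:E|%E))//.
  by rewrite lte_mul_pinfty// lee_fin ltW.
exact: measurableT_comp.
Qed.

(** The nonnegative case is applied to the positive and negative parts. Integrability makes both
    integrals finite, so that [fine] commutes with their difference. *)
Lemma Rintegral_dilation (c : R) (D : set R) (f : R -> R) : 0 < c ->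
  measurable D -> mu.-integrable D (EFin \o f) ->
  \int[mu]_(x in (fun x => x / c) @^-1` D) f (x / c) =
  c * \int[mu]_(x in D) f x.
Proof.
move=> c0 mD fi; have /integrableP[mf _] := fi.
rewrite /Rintegral integralE [in RHS]integralE.
have := @ge0_integral_dilation c D _ c0 mD (measurable_funepos mf) (funepos_ge0 _).
have := @ge0_integral_dilation c D _ c0 mD (measurable_funeneg mf) (funeneg_ge0 _).
have mD' : measurable (D : set (measurableTypeR R)) by [].
have pf : (\int[mu]_(x in D) (EFin \o f)^\+ x \is a fin_num)%E :=
  integrable_fin_num mD' (integrable_funepos mD' fi).
have nf : (\int[mu]_(x in D) (EFin \o f)^\- x \is a fin_num)%E :=
  integrable_fin_num mD' (integrable_funeneg mD' fi).
rewrite /= => hn hp.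
transitivity (fine (c%:E * \int[mu]_(x in D) ((EFin \o f)^\+ x) -
  c%:E * \int[mu]_(x in D) ((EFin \o f)^\- x))%E).
  by rewrite -hn -hp; congr (fine (_ - _)); apply: eq_integral => x _;
    rewrite ?funeposE ?funenegE.
rewrite -[X in (_ * X - _)%E](fineK pf) -[X in (_ - _ * X)%E](fineK nf).
rewrite -!EFinM -EFinB /= -mulrBr; congr (c * _).
by rewrite -fineB.
Qed.

End Dilation.

(** * The integral of a self-similar weak solution over its fan *)

Section SelfSimilar.
Context {R : realType}.
Notation mu := (@lebesgue_measure R).

Lemma integrable_itv (f : R -> R) (x y : R) : continuous f ->
  mu.-integrable `[x, y] (EFin \o f).
Proof.
move=> cf; apply: continuous_compact_integrable; first exact: segment_compact.
exact: continuous_subspaceT.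
Qed.

Lemma Rintegral_derive (F f : R -> R) (x y : R) :
  (forall z : R, is_derive z 1 F (f z)) -> continuous f -> x < y ->
  \int[mu]_(z in `[x, y]) f z = F y - F x.
Proof.
move=> dF cf xy; have dFz z : derivable F z 1 by have [] := dF z.
have cF z : {for z, continuous F}.
  by apply: differentiable_continuous; apply/derivable1_diffP.
rewrite /Rintegral (@continuous_FTC2 _ f F)//.
- exact: continuous_subspaceT.
- by split=> [z _ //||]; [apply: cvg_at_right_filter|apply: cvg_at_left_filter]; exact: cF.
- by move=> z _; rewrite derive1E; have [_] := dF z.
Qed.

Lemma integrable_disjoint_setU (A B : set R) (f : R -> \bar R) :
  measurable (A : set (measurableTypeR R)) ->
  measurable (B : set (measurableTypeR R)) -> [disjoint A & B] ->
  mu.-integrable A f -> mu.-integrable B f -> mu.-integrable (A `|` B) f.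
Proof.
move=> mA mB AB /integrableP[mfA fA] /integrableP[mfB fB]; apply/integrableP.
have mf : measurable_fun (A `|` B : set (measurableTypeR R)) f by apply/measurable_funU.
split=> //; rewrite ge0_integral_setU//; first exact: lte_add_pinfty.
exact: measurableT_comp.
Qed.

Definition step (l r x : R) : R := if x < 0 then l else r.

Lemma integral_step_mul (l r : R) (g : R -> R) (N : R) : 0 <= N ->
  mu.-integrable `[- N, N] (EFin \o g) ->
  mu.-integrable `[- N, N] (fun x => (step l r x * g x)%:E) /\
  \int[mu]_(x in `[- N, N]) (step l r x * g x) =
  l * \int[mu]_(x in `[- N, 0]) g x + r * \int[mu]_(x in `[0, N]) g x.
Proof.
move=> N0 gi.
have E : `[- N, N]%classic = `[- N, 0[ `|` `[0, N] :> set R.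
  by apply: itv_bndbnd_setU; rewrite bnd_simp// oppr_le0.
have D : [disjoint `[- N, 0[%classic : set R & `[0, N]].
  rewrite disj_set2E; apply/eqP/seteqP; split=> x //=.
  by rewrite !in_itv/= => -[/andP[_ x0]] /andP[]; rewrite leNgt x0.
have gl : mu.-integrable `[- N, 0[ (EFin \o g).
  by apply: integrableS gi => //; rewrite E; exact: subsetUl.
have gr : mu.-integrable `[0, N] (EFin \o g).
  by apply: integrableS gi => //; rewrite E; exact: subsetUr.
have sl : {in `[- N, 0[%classic, forall x, step l r x * g x = l * g x}.
  by move=> x; rewrite inE/= in_itv/= /step => /andP[_ ->].
have sr : {in `[0, N]%classic, forall x, step l r x * g x = r * g x}.
  by move=> x; rewrite inE/= in_itv/= /step => /andP[x0 _]; rewrite ltNge x0.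
have si : mu.-integrable `[- N, N] (fun x => (step l r x * g x)%:E).
  rewrite E; apply: integrable_disjoint_setU => //.
    apply: (@eq_integrable _ (measurableTypeR R) _ _ _ _ (fun x => l%:E * (g x)%:E)%E) => //.
      by move=> x xN; rewrite sl// EFinM.
    exact: integrableZl.
  apply: (@eq_integrable _ (measurableTypeR R) _ _ _ _ (fun x => r%:E * (g x)%:E)%E) => //.
    by move=> x xN; rewrite sr// EFinM.
  exact: integrableZl.
split=> //; rewrite E Rintegral_setU -?E//.
have -> : \int[mu]_(x in `[- N, 0[) (step l r x * g x) =
    \int[mu]_(x in `[- N, 0[) (l * g x) by exact: eq_Rintegral.
have -> : \int[mu]_(x in `[0, N]) (step l r x * g x) =
    \int[mu]_(x in `[0, N]) (r * g x) by exact: eq_Rintegral.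
rewrite !RintegralZl//.
by rewrite Rintegral_itv_bndo_bndc.
Qed.

(** Both integrands, extended by zero, are the same function on the line. This trades the unbounded
    domains of [weak_form] for bounded intervals. *)
Lemma Rintegral_eq_support (f g : R -> R) (A B : set R) :
  (forall x, A x -> B x -> f x = g x) ->
  (forall x, A x -> ~ B x -> f x = 0) -> (forall x, B x -> ~ A x -> g x = 0) ->
  \int[mu]_(x in A) f x = \int[mu]_(x in B) g x.
Proof.
move=> fg f0 g0; rewrite Rintegral_mkcond [RHS]Rintegral_mkcond.
apply: eq_Rintegral => x _; rewrite !patchE.
have [xA|xA] := boolP (x \in A); have [xB|xB] := boolP (x \in B) => //.
- by apply: fg; exact: set_mem.
- by apply: f0; [exact: set_mem|move=> /mem_set; exact/negP].
- by apply/esym/g0; [exact: set_mem|move=> /mem_set; exact/negP].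
Qed.

Lemma integrable_locally_itv (a : R -> R) (x y : R) :
  locally_integrable [set: R] a -> mu.-integrable `[x, y] (EFin \o a).
Proof.
move=> [ma _ ia]; apply/integrableP; split.
  by apply/measurable_EFinP; apply: measurable_funS ma.
by apply: ia => //; exact: segment_compact.
Qed.

Lemma integral_step (l r N : R) : 0 <= N ->
  mu.-integrable `[- N, N] (EFin \o step l r) /\
  \int[mu]_(x in `[- N, N]) step l r x = N * (l + r).
Proof.
move=> N0; have c1 : continuous (cst 1 : R -> R) by move=> ?; exact: cvg_cst.
have [si sE] := @integral_step_mul l r (cst 1) N N0 (integrable_itv _ _ c1).
have e : (fun x => (step l r x * cst 1 x)%:E) = EFin \o step l r.
  by apply/funext => x; rewrite /= mulr1.
split; first by rewrite -e.
transitivity (\int[mu]_(x in `[- N, N]) (step l r x * cst 1 x)).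
  by apply: eq_Rintegral => x _; rewrite mulr1.
rewrite sE !Rintegral_cst//= !lebesgue_measure_itv/= !lte_fin oppr_lt0.
move: N0; rewrite le_eqVlt => /predU1P[<-|->].
  by rewrite ltxx /= !mulr0 addr0 mul0r.
by rewrite -!EFinB /= sub0r opprK subr0 !mul1r mulrDr mulrC [r * _]mulrC.
Qed.

Section RiemannFan.
Variables (a b : R -> R) (aL aR bL bR L : R).
Hypothesis L0 : 0 < L.
Hypothesis loca : locally_integrable [set: R] a.
Hypothesis aLE : forall xi : R, xi < - L -> a xi = aL.
Hypothesis aRE : forall xi : R, L < xi -> a xi = aR.
Hypothesis bLE : forall xi : R, xi < - L -> b xi = bL.
Hypothesis bRE : forall xi : R, L < xi -> b xi = bR.

(** The excess of the fan over the initial step at time [1], since the step has integral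
    [L * (aL + aR)] over [[-L, L]]. *)
Let J := \int[mu]_(xi in `[- L, L]) a xi - L * (aL + aR).

Lemma outside_fan (w : R -> R) (wL wR x t : R) : 0 < t ->
  (forall xi : R, xi < - L -> w xi = wL) -> (forall xi : R, L < xi -> w xi = wR) ->
  L * t < `|x| -> w (x / t) = step wL wR x.
Proof.
move=> t0 wl wr; have Lt0 : 0 < L * t by exact: mulr_gt0.
rewrite lter_normr /step => /orP[xt|xt].
  by rewrite ltNge (ltW (lt_trans Lt0 xt)) wr// ltr_pdivlMr.
have x0 : x < 0 by rewrite -oppr_gt0 (lt_trans Lt0).
by rewrite x0 wl// ltr_pdivrMr// mulNr ltrNr.
Qed.

(** By self-similarity the profile at time [t] is that at time [1] stretched by [t], so the excess
    grows linearly in time. *)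
Lemma integral_fan_dilation (t : R) : 0 < t ->
  mu.-integrable `[- (L * t), L * t] (fun x => (a (x / t) - step aL aR x)%:E) /\
  \int[mu]_(x in `[- (L * t), L * t]) (a (x / t) - step aL aR x) = t * J.
Proof.
move=> t0; have Lt0 : 0 <= L * t by rewrite mulr_ge0 ?ltW.
have ai := @integrable_locally_itv a (- L) L loca.
have := @integrable_dilation R t _ a t0 (measurable_itv _) ai.
have := @Rintegral_dilation R t _ a t0 (measurable_itv _) ai.
rewrite preimage_dilation_itv// mulNr => aE aint.
have [si sE] := integral_step aL aR Lt0.
split; first exact: (integrableB _ aint si).
by rewrite RintegralB// aE sE /J mulrBr; congr (_ - _); ring.
Qed.

Section Test.
Variable K : R.
Let A0 := \int[mu]_(x in `[- (K + 1), K + 1]) (step aL aR x * plateau K x).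

(** Write [a (x / t)] as the step plus an excess living on [|x| <= L * t]. There the plateau is [1]
    and its derivative [0], so the excess contributes [t * J] and the values of [b] inside the fan
    are multiplied by zero. Outside, [b (x / t)] is a step. *)
Lemma integral_fan_test (t u v : R) : 0 < t -> L * t <= K ->
  \int[mu]_x (a (x / t) * (plateau K x * u) + b (x / t) * (v * dplateau K x)) =
  u * (A0 + t * J) + v * (bL - bR).
Proof.
move=> t0 LtK; have Lt0 : 0 < L * t by exact: mulr_gt0.
have K0 : 0 < K by exact: lt_le_trans LtK.
pose N := K + 1; have N0 : 0 < N by rewrite addr_gt0.
pose d x : R := a (x / t) - step aL aR x.
pose I := `[- (L * t), L * t]%classic : set R.
pose dI : R -> R := patch (fun=> 0) I d.
have [di dE] := integral_fan_dilation t0.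
have [si _] := @integral_step_mul aL aR _ _ (ltW N0)
  (integrable_itv _ _ (@continuous_plateau R K)).
have [ri rE] := @integral_step_mul bL bR _ _ (ltW N0)
  (integrable_itv _ _ (@continuous_dplateau R K)).
have IN : I `<=` `[- N, N].
  by apply: subset_itv; rewrite bnd_simp; rewrite /N; lra.
have dIi : mu.-integrable `[- N, N] (EFin \o dI).
  have mI : measurable (I : set (measurableTypeR R)) by exact: measurable_itv.
  have mN : measurable (`[- N, N]%classic : set (measurableTypeR R)).
    exact: measurable_itv.
  rewrite -restrict_EFin.
  by apply: (proj1 (integrable_restrict mu mI mN (EFin \o d))); rewrite setIidr.
have dIE : \int[mu]_(x in `[- N, N]) (dI x) = t * J.
  by rewrite -Rintegral_mkcondr setIidr.
pose F x : R := step aL aR x * plateau K x + dI x.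
pose G x : R := step bL bR x * dplateau K x.
transitivity (\int[mu]_(x in `[- N, N]) (u * F x + v * G x)).
  rewrite /F /G; apply: Rintegral_eq_support => [x _|x _|x _ []//].
    move=> _; have [xI|xI] := boolP (x \in I).
      have xK : `|x| <= K.
        move: xI; rewrite inE /I /= in_itv/= -ler_norml => xI.
        exact: le_trans LtK.
      by rewrite /dI patchE xI plateau1// dplateau0// /d; ring.
    have xt : L * t < `|x|.
      by rewrite ltNge; apply: contra xI; rewrite inE /I /= in_itv/= -ler_norml.
    rewrite /dI patchE (negbTE xI) (outside_fan t0 aLE aRE xt).
    by rewrite (outside_fan t0 bLE bRE xt) /= -[point]/(0 : R); ring.
  rewrite /= in_itv/= -ler_norml => /negP; rewrite -ltNge => /ltW Nx.
  by rewrite plateau0 ?dplateau0_out ?(ltW K0)// mul0r !mulr0 addr0.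
have Fi : mu.-integrable `[- N, N] (EFin \o F) by exact: (integrableD _ si dIi).
have Gi : mu.-integrable `[- N, N] (EFin \o G) by exact: ri.
transitivity (\int[mu]_(x in `[- N, N]) (u * F x) +
    \int[mu]_(x in `[- N, N]) (v * G x)).
  apply: RintegralD => //.
  - exact: (integrableZl _ u Fi).
  - exact: (integrableZl _ v Gi).
have FE : \int[mu]_(x in `[- N, N]) F x = A0 + t * J.
  by rewrite -dIE; apply: RintegralD.
rewrite !RintegralZl// FE rE; congr (_ + v * _).
have dK : forall z : R, is_derive z 1 (plateau K) (dplateau K z).
  exact: is_derive_plateau.
(* The plateau rises from [0] to [1] on [[-N, 0]] and falls back on [[0, N]], which weights [bL] by
   [1] and [bR] by [-1]. *)
rewrite !(Rintegral_derive dK) ?oppr_lt0//; [|exact: continuous_dplateau..].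
have p0 : plateau K 0 = 1 by rewrite plateau1// normr0 ltW.
have pN : plateau K N = 0 by rewrite plateau0 ?(ltW K0)// (ger0_norm (ltW N0)).
have pNN : plateau K (- N) = 0.
  by rewrite plateau0 ?(ltW K0)// normrN (ger0_norm (ltW N0)).
by rewrite p0 pN pNN; ring.
Qed.

End Test.

(** The tested equation reads [A0 + \int H = 0], where [H] is the derivative of [q t * (A0 + t * J)]
    plus [c * q t]. The derivative integrates to [- A0], cancelling the initial term, and
    [c * \int q = 0] remains; as [\int q > 0], [c = 0], that is, [J = bL - bR]. *)
Lemma integral_riemann_fan :
  (forall phi, test_function phi -> weak_form a b aL aR phi = 0) ->
  \int[mu]_(xi in `[- L, L]) a xi = L * (aL + aR) - (bR - bL).
Proof.
(* The time cut-off [plateau 1] vanishes from [t = 2] on, so [L * t <= K] at every time that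
   counts. *)
pose K := L * 2; have K0 : 0 < K by rewrite mulr_gt0.
pose p := plateau K; pose q : R -> R := plateau 1.
pose dp := dplateau K; pose dq : R -> R := dplateau 1.
have dpP (x : R) : is_derive x 1 p (dp x) by exact: is_derive_plateau.
have dqP (x : R) : is_derive x 1 q (dq x) by exact: is_derive_plateau.
have cdp : continuous dp by exact: continuous_dplateau.
have cdq : continuous dq by exact: continuous_dplateau.
have cq : continuous q by exact: continuous_plateau.
have q0E : q 0 = 1 by rewrite /q plateau1// normr0.
have q_out t : 2 <= `|t| -> q t = 0 /\ dq t = 0.
  by move=> t2; rewrite /q /dq plateau0 ?dplateau0_out//; lra.
have tphi : test_function (fun z : R^o * R^o => p z.1 * q z.2 : R^o).
  apply: (@test_function_prod R p q dp dq (K + 2)) => // x Kx.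
    by rewrite /p plateau0//; lra.
  by apply: (q_out x _).1; lra.
move=> /(_ _ tphi).
rewrite /weak_form.
pose A0 := \int[mu]_(x in `[- (K + 1), K + 1]) (step aL aR x * p x).
have -> : \int[mu]_(x in [set: R])
    ((if x < 0 then aL else aR) * (p (x, 0 : R^o).1 * q (x, 0 : R^o).2)) = A0.
  rewrite /A0; apply: Rintegral_eq_support => [x _ _|x _|x _ []//]; first by rewrite /= q0E mulr1.
  rewrite /= in_itv/= -ler_norml => /negP; rewrite -ltNge => /ltW Kx.
  by rewrite /p plateau0 ?(ltW K0)// mul0r mulr0.
pose H t := dq t * (A0 + t * J) + q t * (bL - bR).
pose c := bL - bR - J.
have -> : \int[mu]_(t in `]0, +oo[) (\int[mu]_(x in [set: R])
    (a (x / t) * 'D_(0, 1) (fun z : R^o * R^o => p z.1 * q z.2 : R^o) (x, t) +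
     b (x / t) * 'D_(1, 0) (fun z : R^o * R^o => p z.1 * q z.2 : R^o) (x, t))) =
    \int[mu]_(t in `]0, 2]) H t.
  have inner t : \int[mu]_(x in [set: R])
      (a (x / t) * 'D_(0, 1) (fun z : R^o * R^o => p z.1 * q z.2 : R^o) (x, t) +
       b (x / t) * 'D_(1, 0) (fun z : R^o * R^o => p z.1 * q z.2 : R^o) (x, t)) =
      \int[mu]_x (a (x / t) * (p x * dq t) + b (x / t) * (q t * dp x)).
    apply: eq_Rintegral => x _; rewrite !(derive_prod_fun dpP dqP) /=.
    by rewrite !mul1r !mul0r !mulr0 addr0 add0r.
  apply: Rintegral_eq_support => t /=; rewrite !in_itv/= ?andbT.
  - by move=> t0 /andP[_ t2]; rewrite inner integral_fan_test// /K ler_pM2l.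
  - move=> t0; rewrite t0 /= => /negP; rewrite -ltNge => /ltW t2.
    have [|qt dqt] := q_out t; first by rewrite ger0_norm// ltW.
    rewrite inner qt dqt; transitivity (\int[mu]_(x in [set: R]) (0 : R)).
      by apply: eq_Rintegral => x _; rewrite mul0r !mulr0 addr0.
    by rewrite Rintegral_cst// mul0r.
  - by move=> /andP[-> _] [].
have cu : continuous (fun t : R => A0 + t * J).
  by move=> t; apply: cvgD; [exact: cvg_cst|apply: cvgM; [exact: cvg_id|exact: cvg_cst]].
pose dF t := dq t * (A0 + t * J) + q t * J.
have cdF : continuous dF.
  move=> t; apply: cvgD; apply: cvgM; [exact: cdq|exact: cu|exact: cq|exact: cvg_cst].
have dFP (t : R) : is_derive t 1 (fun t => q t * (A0 + t * J)) (dF t).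
  have := dqP t => ?; apply: is_derive_eq.
  rewrite /dF /GRing.scale /=; ring.
have HE t : H t = dF t + c * q t by rewrite /H /dF /c; ring.
have dFi := integrable_itv 0 2 cdF.
have qi := integrable_itv 0 2 cq.
have cqi : mu.-integrable `[0, 2] (fun t => (c * q t)%:E).
  exact: (integrableZl _ c qi).
have Hi : mu.-integrable `[0, 2] (EFin \o H).
  have -> : EFin \o H = (fun t => (dF t)%:E + (c * q t)%:E)%E.
    by apply/funext => t; rewrite /= HE.
  exact: (integrableD _ dFi cqi).
rewrite Rintegral_itv_obnd_cbnd; last first.
  by apply: integrableS Hi => //; apply: subset_itvr; rewrite bnd_simp.
have -> : \int[mu]_(t in `[0, 2]) H t = - A0 + c * \int[mu]_(t in `[0, 2]) q t.
  transitivity (\int[mu]_(t in `[0, 2]) (dF t + c * q t)).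
    by apply: eq_Rintegral => t _; exact: HE.
  rewrite RintegralD// RintegralZl// (Rintegral_derive dFP)//.
  by rewrite (q_out 2 _).1 ?ger0_norm// q0E mul0r mul0r addr0 mul1r sub0r.
(* [q] dominates the indicator of [[0, 1]], whose integral is [1]. *)
have q_gt0 : 0 < \int[mu]_(t in `[0, 2]) q t.
  apply: (@lt_le_trans _ _ (\int[mu]_(t in `[0, 2]) (\1_(`[0, 1]%classic : set R) t))).
    rewrite /Rintegral integral_indic// setIidl; last first.
      by apply: subset_itvl; rewrite bnd_simp ler1n.
    rewrite -[ltRHS]/(fine (mu `[0, 1]%classic)).
    by rewrite lebesgue_measure_itv/= lte_fin ltr01 -EFinB /= subr0.
  apply: le_Rintegral => //.
    by apply: integrableS (integrable_indic_itv 0 1 true false) => //.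
  move=> t _; rewrite indicE; case: (boolP (t \in _)) => /=; last first.
    by rewrite /q plateau_ge0.
  rewrite inE/= in_itv/= => /andP[t0 t1].
  by rewrite /q plateau1// ger0_norm.
rewrite addrAC addNr add0r => /eqP; rewrite mulf_eq0 (gt_eqF q_gt0) orbF.
by rewrite /c /J => /eqP h; lra.
Qed.
End RiemannFan.
End SelfSimilar.

(** * The closed formula for the Riemann average *)

Section RiemannAverage.
Context {R : realType} {m d : nat}.

(** In the variable [xi = x / dt] the cell [[-h/2, h/2]] becomes [[-L, L]] with [L = h / 2 / dt].
    The CFL condition says exactly that the wave speed is at most [L], so [integral_riemann_fan]
    applies componentwise. *)
Lemma riemann_averageE (Omega : set 'cV[R]_m) (f : 'cV[R]_m -> 'M[R]_(m, d))
    (E : set (('cV[R]_m -> R) * ('cV[R]_m -> 'rV[R]_d))) (W : riemann_data R m d)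
    (uL uR : 'cV[R]_m) (n : 'cV[R]_d) (h dt : R) :
  riemann_solver Omega f E W -> Omega uL -> Omega uR -> unit_vector n ->
  0 < h -> 0 < dt -> dt / h * max_wave_speed W uL uR n <= 1 / 2 ->
  riemann_average W h dt uL uR n =
  2^-1 *: (uL + uR) - (dt / h) *: ((f uR - f uL) *m n).
Proof.
move=> RW OL OR n1 h0 dt0 cfl.
have [_ [weak _] fanL fanR] := RW _ _ _ OL OR n1.
pose L := h / 2 / dt; have L0 : 0 < L by rewrite !divr_gt0.
have speedL : max_wave_speed W uL uR n <= L.
  move: cfl; rewrite mulrAC ler_pdivrMr// mulrC -ler_pdivlMr//.
  by rewrite /L; congr (_ <= _ / _); rewrite mul1r mulrC.
have sL : - L <= sigmaL W uL uR n.
  rewrite lerNl (le_trans _ speedL)// /max_wave_speed le_max.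
  by rewrite (le_trans (ler_norm _)) ?normrN ?lexx.
have sR : sigmaR W uL uR n <= L.
  rewrite (le_trans _ speedL)// /max_wave_speed le_max.
  by rewrite ler_norm orbT.
apply/colP => i; rewrite mulmxBl !mxE /=.
have [loca _ wk] := weak i.
have fL xi : xi < - L -> fan W xi uL uR n = uL.
  by move=> xiL; apply: fanL; exact: lt_le_trans sL.
have fR xi : L < xi -> fan W xi uL uR n = uR.
  by move=> xiL; apply: fanR; exact: le_lt_trans xiL.
have aE : \int[lebesgue_measure]_(x in `[- (h / 2), h / 2]) fan W (x / dt) uL uR n i 0 =
    dt * \int[lebesgue_measure]_(x in `[- L, L]) fan W x uL uR n i 0.
  rewrite -(@Rintegral_dilation R dt `[- L, L] (fun x => fan W x uL uR n i 0))//.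
    rewrite preimage_dilation_itv// mulNr.
    by rewrite (_ : L * dt = h / 2) // /L divfK ?gt_eqF.
  exact: integrable_locally_itv.
rewrite aE (@integral_riemann_fan R _ (fun xi => (f (fan W xi uL uR n) *m n) i 0)
  (uL i 0) (uR i 0) ((f uL *m n) i 0) ((f uR *m n) i 0) L L0 loca) //; last 4 first.
- by move=> xi /fL ->.
- by move=> xi /fR ->.
- by move=> xi /fL ->.
- by move=> xi /fR ->.
rewrite !mxE /L; field.
by rewrite !gt_eqF.
Qed.

End RiemannAverage.

(** Induction on the number of points: the tail weights, divided by their sum [t], again form a
    convex combination. The empty case is excluded because its weights sum to [0]. *)
Lemma convex_set_sum (R : realType) (V : lmodType R) (A : set V) (n : nat)
    (g : 'I_n -> R) (v : 'I_n -> V) :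
  convex_set (A : set (convex_lmodType V)) ->
  (forall i, 0 <= g i) -> \sum_i g i = 1 -> (forall i, A (v i)) ->
  A (\sum_i g i *: v i).
Proof.
move=> cA; elim: n g v => [|n IHn] g v g0 g1 Av.
  by move: g1; rewrite big_ord0 => /eqP; rewrite eq_sym oner_eq0.
rewrite big_ord_recl; move: g1; rewrite big_ord_recl => g1.
set t := \sum_(i < n) g (lift ord0 i) in g1.
have t_ge0 : 0 <= t by exact: sumr_ge0.
(* The tail cannot be normalised when [t = 0], but then all its weights vanish and only the first
   point is left. *)
have [t0|t0] := eqVneq t 0.
  rewrite big1 ?addr0.
    by move: g1; rewrite t0 addr0 => ->; rewrite scale1r.
  move=> i _; have /eqP := t0; rewrite psumr_eq0// => /allP/(_ i).
  by rewrite mem_index_enum => /(_ isT)/eqP ->; rewrite scale0r.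
have g01 : g ord0 <= 1 by rewrite -g1 lerDl.
have -> : \sum_(i < n) g (lift ord0 i) *: v (lift ord0 i) =
    (1 - g ord0) *: \sum_(i < n) (g (lift ord0 i) / t) *: v (lift ord0 i).
  rewrite -g1 addrAC subrr add0r scaler_sumr; apply: eq_bigr => i _.
  by rewrite scalerA mulrCA divff// mulr1.
apply: set_mem; apply: (cA _ _ (Itv01 (g0 ord0) g01)); rewrite inE//.
apply: IHn => [i||i]; last exact: Av.
- by rewrite divr_ge0.
- by rewrite -mulr_suml divff.
Qed.

(** * Membership of the star state in the invariant domain *)

Section StarState.
Context {R : realType} {m d N : nat}.
Variables (Omega B : set 'cV[R]_m) (f : 'cV[R]_m -> 'M[R]_(m, d)).
Variables (E : set (('cV[R]_m -> R) * ('cV[R]_m -> 'rV[R]_d))).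
Variables (W : riemann_data R m d).
Hypothesis RW : riemann_solver Omega f E W.
Hypothesis invB : invariant_domain Omega W B.
Variables (g : 'I_N -> R) (v : 'I_N -> 'cV[R]_m) (nrm : 'I_N -> 'cV[R]_d).
Hypothesis g0 : forall k, 0 <= g k.
Hypothesis g1 : \sum_k g k = 1.
Hypothesis nrm1 : forall k, unit_vector (nrm k).
Hypothesis closed_surface : \sum_k g k *: nrm k = 0.
Hypothesis Bv : forall k, B (v k).

Let w := \sum_k g k *: v k.
Let c := \sum_k g k *: (f (v k) *m nrm k).

Lemma mean_state_in : B w.
Proof. by have [cB _ _] := invB; exact: convex_set_sum. Qed.

Lemma closed_surface_flux (A : 'M[R]_(m, d)) : \sum_k g k *: (A *m nrm k) = 0.
Proof.
under eq_bigr do rewrite scalemxAr.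
by rewrite -mulmx_sumr closed_surface mulmx0.
Qed.

Lemma star_state_in (lambda : R) : 0 < lambda ->
  (forall k, max_wave_speed W w (v k) (nrm k) <= lambda) ->
  B (w - (2 * lambda)^-1 *: c).
Proof.
move=> l0 speed; have [cB BO avgB] := invB.
have l20 : 0 < 2 * lambda by rewrite mulr_gt0.
have cfl k : 1 / (2 * lambda) * max_wave_speed W w (v k) (nrm k) <= 1 / 2.
  by rewrite !div1r mulrC ler_pdivrMr// mulrA mulVf// mul1r.
(* With cell size [2 * lambda] and time step [1], the CFL condition becomes
   [max_wave_speed <= lambda], and each Riemann average carries its flux difference with the factor
   [(2 * lambda)^-1]. *)
have -> : w - (2 * lambda)^-1 *: c =
    \sum_k g k *: riemann_average W (2 * lambda) 1 w (v k) (nrm k).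
  transitivity (\sum_k (2^-1 *: (g k *: w) + 2^-1 *: (g k *: v k) -
      (2 * lambda)^-1 *: (g k *: (f (v k) *m nrm k)) +
      (2 * lambda)^-1 *: (g k *: (f w *m nrm k)))).
    rewrite big_split sumrB big_split /= -!scaler_sumr -scaler_suml g1 scale1r.
    rewrite closed_surface_flux scaler0 addr0 -scalerDl.
    by rewrite -/c -/w (_ : 2^-1 + 2^-1 = 1) ?scale1r//; field.
  apply: eq_bigr => k _.
  rewrite (riemann_averageE RW)//; [|exact/BO/mean_state_in|exact/BO/Bv].
  rewrite mulmxBl mul1r !scalerBr !scalerDr !scalerA opprB addrA.
  by rewrite addrAC ![g k * _]mulrC.
by apply: convex_set_sum => // k; apply: avgB => //; exact: mean_state_in.
Qed.

End StarState.

(** * Choice of the speed and verification of the star state *)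

Theorem lemma3p4 (R : realType) (m d : nat)
  (* the hyperbolic system and its Riemann solver *)
  (Omega : set 'cV[R]_m) (f : 'cV[R]_m -> 'M[R]_(m, d))
  (E : set (('cV[R]_m -> R) * ('cV[R]_m -> 'rV[R]_d)))
  (W : riemann_data R m d)
  (HOmega : convex_set (Omega : set (convex_lmodType 'cV[R]_m)))
  (Hf : smooth_near Omega f)
  (Hhyp : hyperbolic Omega f)
  (HE : forall e, E e -> entropy_pair Omega f e)
  (HW : riemann_solver Omega f E W)
  (* the invariant domain and the two-point flux *)
  (B : set 'cV[R]_m) (HB : invariant_domain Omega W B)
  (HWB : locally_bounded_wave_speed W B)
  (h : 'cV[R]_m -> 'cV[R]_m -> 'cV[R]_d -> 'cV[R]_m)
  (Hh : two_point_flux Omega f W B h)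
  (* the mesh, the time levels, the approximate solution, its cell averages *)
  (D : set 'cV[R]_d) (Th : set (set 'cV[R]_d)) (HTh : mesh D Th)
  (t dt : nat -> R) (Hdt : forall n, 0 < dt n)
  (Ht : forall n, t n.+1 = t n + dt n)
  (uh : 'cV[R]_d -> R -> 'cV[R]_m)
  (avg : set 'cV[R]_d -> ('cV[R]_d -> 'cV[R]_m) -> 'cV[R]_m)
  (* the cell kappa and its quadrature data *)
  (kappa : set 'cV[R]_d) (Hkappa : Th kappa)
  (Nf Nv : nat) (HNf : (0 < Nf)%N)
  (x nrm : 'I_Nf -> 'cV[R]_d) (s beta : 'I_Nf -> R)
  (y : 'I_Nv -> 'cV[R]_d) (nu : 'I_Nv -> R)
  (Hx : forall k, outward_normal kappa (x k) (nrm k))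
  (Hs : forall k, 0 < s k)
  (Hy : forall i, kappa (y i))
  (n : nat)
  (Htr : forall k, has_traces (uh ^~ (t n)) (x k) (nrm k)) :
  let um k := inner_trace (uh ^~ (t n)) (x k) (nrm k) in
  let up k := outer_trace (uh ^~ (t n)) (x k) (nrm k) in
  (* cell-averaged update *)
  avg kappa (uh ^~ (t n.+1)) =
    avg kappa (uh ^~ (t n)) - dt n *: (\sum_k s k *: h (um k) (up k) (nrm k)) ->
  (* quadrature *)
  avg kappa (uh ^~ (t n)) =
    \sum_i nu i *: uh (y i) (t n) + \sum_k beta k *: um k ->
  (forall i, 0 <= nu i) -> (forall k, 0 < beta k) ->
  \sum_i nu i + \sum_k beta k = 1 ->
  (* closed surface *)
  \sum_k s k *: nrm k = 0 ->
  (forall k, B (um k)) ->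
  let gamma k := s k / \sum_i s i in
  exists (ustar : 'cV[R]_m) (lambda : R),
    [/\ B ustar, 0 < lambda,
        \sum_k s k *: rusanov_flux f lambda ustar (um k) (nrm k) = 0,
        \big[Num.max/0]_k max_wave_speed W ustar (um k) (nrm k) <= lambda
      & ustar = \sum_k gamma k *: (um k - lambda^-1 *: (f (um k) *m nrm k))].
Proof.
move=> um up _ _ _ _ _ closed Bum gamma.
pose S := \sum_i s i.
have S0 : 0 < S.
  rewrite /S (bigD1 (Ordinal HNf))//= ltr_pwDl ?Hs// sumr_ge0// => i _.
  exact: ltW.
have g0 k : 0 <= gamma k by rewrite divr_ge0// ltW.
have g1 : \sum_k gamma k = 1 by rewrite -mulr_suml divff// gt_eqF.
have nrm1 k : unit_vector (nrm k) by have [] := Hx k.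
have gn : \sum_k gamma k *: nrm k = 0.
  under eq_bigr do rewrite /gamma mulrC -scalerA.
  by rewrite -scaler_sumr closed scaler0.
pose w : 'cV[R]_m := \sum_k gamma k *: um k.
pose c : 'cV[R]_m := \sum_k gamma k *: (f (um k) *m nrm k).
have Bw : B w := mean_state_in HB g0 g1 Bum.
(* Each face has its own bound and neighbourhood of [w]; as there are finitely many faces, one ball
   of radius [e] serves them all. *)
have [M HM] := choice (fun k => HWB _ _ _ Bw (Bum k) (nrm1 k)).
have : \forall v \near within B (nbhs w),
    forall k, max_wave_speed W v (um k) (nrm k) <= M k.
  exact: filter_forall.
rewrite near_withinE => /nbhs_normP[e /= e0 He].
pose M1 := 1 + \sum_k `|M k|.
have M1_gt0 : 0 < M1 by rewrite ltr_pwDl ?sumr_ge0.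
have MM1 k : M k <= M1.
  rewrite /M1 (bigD1 k)//= (le_trans (ler_norm _))// addrCA lerDl.
  by rewrite addr_ge0// sumr_ge0.
(* Half of [lambda] bounds the wave speeds at [w], as [star_state_in] requires. Also
   [lambda * e > |c|], which puts [w - lambda^-1 *: c] within distance [e] of [w]. *)
pose lambda := 2 * (M1 + `|c| / e).
have ce0 : 0 <= `|c| / e by rewrite divr_ge0// ltW.
have l0 : 0 < lambda by rewrite mulr_gt0// ltr_pwDl.
have gS k : s k = S * gamma k by rewrite /gamma mulrC divfK// gt_eqF.
have Bstar : B (w - lambda^-1 *: c).
  apply: (star_state_in HW HB) => // [|k]; first by rewrite ltr_pwDl.
  rewrite (le_trans (He w _ Bw k))//= ?subrr ?normr0//.
  by rewrite (le_trans (MM1 k))// lerDl.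
exists (w - lambda^-1 *: c), lambda; split=> //.
(* After division by [S] the sum is [c / 2 - (lambda / 2) (w - u)], because the closed surface
   removes the terms in [f u]; it vanishes since [w - u = c / lambda]. *)
- under eq_bigr do rewrite gS -scalerA /rusanov_flux.
  rewrite -scaler_sumr; apply/eqP; rewrite scaler_eq0 gt_eqF//=; apply/eqP.
  set u := w - _.
  transitivity (2^-1 *: \sum_k gamma k *: (f u *m nrm k) + 2^-1 *: c -
     (lambda / 2) *: (w - \sum_k gamma k *: u)).
    rewrite -sumrB !scaler_sumr -big_split -sumrB /=; apply: eq_bigr => k _.
    by rewrite !scalerBr !scalerDr !scalerA ![gamma k * _]mulrC.
  rewrite (closed_surface_flux gn) scaler0 add0r -scaler_suml g1 scale1r.
  rewrite /u opprB addrCA subrr addr0 scalerA mulrAC divff ?gt_eqF// mul1r.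
  by rewrite subrr.
- apply: bigmax_le => [|k _]; first exact: ltW.
  (* The local bound holds only for states of [B] in the ball, so membership in [B] has to be known
     before the speeds at the star state can be estimated. *)
  have := He (w - lambda^-1 *: c) _ Bstar k => /(_ _)/le_trans; apply.
    rewrite /= opprB addrC subrK normrZ gtr0_norm ?invr_gt0//.
    rewrite mulrC ltr_pdivrMr// -ltr_pdivrMl// mulrC /lambda.
    by lra.
  rewrite (le_trans (MM1 k))// /lambda; lra.
- rewrite /c scaler_sumr -sumrB; apply: eq_bigr => k _.
  by rewrite scalerBr !scalerA [lambda^-1 * _]mulrC.
Qed.
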